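(* Let $G$ be a short dicotic game in misère dicotic canonical form. Then $G$ is invertible in the misère dicotic universe if and only if there is no follower $G'$ of $G$ (with $G$ itself counted as a follower of $G$) such that $G'+(-G')$ is a $\mathscr P$-position (previous player wins under misère play).
   Context: Games are short combinatorial games $G=\{G^{\mathcal L}\mid G^{\mathcal R}\}$ (finitely many distinct subpositions, no infinite run) under misère play (the last player to move loses). A game is dicotic if every subposition $G'$ satisfies $G'^{\mathcal L}=\emptyset$ iff $G'^{\mathcal R}=\emptyset$. A follower of $G$ is any position reachable from $G$, including $G$. Disjunctive sum: $G+H=\{G^{\mathcal L}+H,\,G+H^{\mathcal L}\mid G^{\mathcal R}+H,\,G+H^{\mathcal R}\}$; conjugate: $-G=\{-G^{\mathcal R}\mid -G^{\mathcal L}\}$ recursively. Outcome classes: $\mathscr L$ (Left wins moving first or second), $\mathscr R$ (Right wins either way), $\mathscr N$ (next player wins), $\mathscr P$ (previous player wins), ordered $\mathscr L>\mathscr P,\mathscr N>\mathscr R$. Let $\mathcal D^-$ be the class of short dicotic games under misère play; for $G,H\in\mathcal D^-$, $G\succcurlyeq H$ iff $o(G+X)\ge o(H+X)$ for all $X\in\mathcal D^-$, and $G=H$ iff $o(G+X)=o(H+X)$ for all $X\in\mathcal D^-$. $G$ is invertible if there is $H\in\mathcal D^-$ with $G+H=0$ (where $0=\{\,\mid\,\}$). Canonical form: a dicotic form is in canonical form if none of the following reductions (all preserving equality modulo $\mathcal D^-$) can be applied to it or to any of its followers to change its sets of options: (i) removing a dominated option (a left option $A$ with $A\preccurlyeq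 B$ for another left option $B$, and dually for Right); (ii) non-atomic reversibility: if $A\in G^{\mathcal L}$ has a right option $B\preccurlyeq G$ with $B^{\mathcal L}\neq\emptyset$, replace $A$ by the left options of $B$ (dually for Right); (iii) atomic reversibility: if $A\in G^{\mathcal L}$ has a right option $B=0$ with $B\preccurlyeq G$ (B left-atomic), remove $A$ if Left has another winning first move in $G$, and otherwise replace $A$ by $*=\{0\mid 0\}$ (dually for Right); (iv) substitution: if $G=\{A\mid C\}$ with $A$, $C$ atomic-reversible, replace $G$ by $0$. Canonical forms in $\mathcal D^-$ are unique. *)

(* Defs.v *)
From HB Require Import structures.
From mathcomp Require Import all_boot.

Set Implicit Arguments.
Unset Strict Implicit.
Unset Printing Implicit Defensive.

(* Short games. A node carries finite lists of options, which represent the   *)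
(* option *sets*: order and repetitions are irrelevant, and two lists-of-     *)
(* options trees denote the same form exactly when they are related by [same] *)
(* below (hereditary set equality).                                           *)
Inductive game : Type := Game of seq game & seq game.

Definition lopts (G : game) : seq game := let: Game L _ := G in L.
Definition ropts (G : game) : seq game := let: Game _ R := G in R.

(* Coq's generated principle has no hypothesis for the nested lists. *)
Fixpoint game_nested_ind (P : game -> Prop)
    (H : forall L R, foldr (fun X => and (P X)) True L ->
                     foldr (fun X => and (P X)) True R -> P (Game L R))
    (G : game) : P G :=
  let fix loop (s : seq game) : foldr (fun X => and (P X)) True s :=
    if s is X :: s' then conj (game_nested_ind H X) (loop s') else I in
  let: Game L R := G in H L R (loop L) (loop R).

(* Countable structure (hence syntactic equality and \in) via generic trees. *)
Fixpoint game_encode (G : game) : GenTree.tree void :=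
  let: Game L R := G in
  GenTree.Node 0 [:: GenTree.Node 0 (map game_encode L);
                     GenTree.Node 0 (map game_encode R)].

Fixpoint game_decode (t : GenTree.tree void) : game :=
  match t with
  | GenTree.Node _ [:: GenTree.Node _ l; GenTree.Node _ r] =>
      Game (map game_decode l) (map game_decode r)
  | _ => Game [::] [::]
  end.

Lemma game_encodeK : cancel game_encode game_decode.
Proof.
elim/game_nested_ind=> L R hL hR /=; congr Game.
  by elim: L hL => //= X s IHs [-> /IHs ->].
by elim: R hR => //= X s IHs [-> /IHs ->].
Qed.

HB.instance Definition _ := Countable.copy game (can_type game_encodeK).

Fixpoint same (G H : game) {struct G} : bool :=
  let: Game L R := G in
  let: Game L' R' := H in
  [&& all (fun X => has (fun Y => same X Y) L') L,
      all (fun Y => has (fun X => same X Y) L) L',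
      all (fun X => has (fun Y => same X Y) R') R
    & all (fun Y => has (fun X => same X Y) R) R'].

Definition zero : game := Game [::] [::].
Definition star : game := Game [:: zero] [:: zero].

Fixpoint gadd (G : game) : game -> game :=
  fix gaddG (H : game) : game :=
    Game (map (fun X => gadd X H) (lopts G) ++ map gaddG (lopts H))
         (map (fun X => gadd X H) (ropts G) ++ map gaddG (ropts H)).

Fixpoint gneg (G : game) : game :=
  let: Game L R := G in Game (map gneg R) (map gneg L).

(* Positions reachable by any sequence of moves, not necessarily alternating. *)
Inductive follower (G : game) : game -> Prop :=
| follower_refl : follower G G
| follower_left F X : follower G F -> X \in lopts F -> follower G X
| follower_right F X : follower G F -> X \in ropts F -> follower G X.

Definition dicotic (G : game) : Prop :=
  forall F, follower G F -> (lopts F = [::] <-> ropts F = [::]).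

Inductive player := Left | Right.
Definition opponent (p : player) : player :=
  if p is Left then Right else Left.

(* [p] wins moving first under misere play: a player unable to move wins. *)
Fixpoint wins_first (p : player) (G : game) {struct G} : bool :=
  let: Game L R := G in
  let s := match p with Left => L | Right => R end in
  nilp s || has (fun X => ~~ wins_first (opponent p) X) s.

Inductive outcome_class := OL | OP | ON | OR.

Definition outcome (G : game) : outcome_class :=
  match wins_first Left G, wins_first Right G with
  | true, false => OL
  | true, true => ON
  | false, false => OP
  | false, true => OR
  end.

(* The partial order L > P, N > R, with P and N incomparable. *)
Definition outcome_ge (a b : outcome_class) : bool :=
  match a, b with
  | OL, _ | _, OR | OP, OP | ON, ON => true
  | _, _ => false
  end.

Definition dge (G H : game) : Prop :=
  forall X, dicotic X -> outcome_ge (outcome (gadd G X)) (outcome (gadd H X)).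

Definition deq (G H : game) : Prop :=
  forall X, dicotic X -> outcome (gadd G X) = outcome (gadd H X).

Definition invertible (G : game) : Prop :=
  exists H, dicotic H /\ deq (gadd G H) zero.

(* Set difference: drops every list entry denoting the same form as [A]. *)
Definition remove (A : game) (s : seq game) : seq game :=
  [seq X <- s | ~~ same X A].

(* [A] is reversible through the atom 0 as a left (resp. right) option of G. *)
Definition latomic_rev (G A : game) : Prop := zero \in ropts A /\ dge G zero.
Definition ratomic_rev (G C : game) : Prop := zero \in lopts C /\ dge zero G.

Inductive reduces (G : game) : game -> Prop :=
| dominated_left A B :
    A \in lopts G -> B \in lopts G -> ~~ same A B -> dge B A ->
    reduces G (Game (remove A (lopts G)) (ropts G))
| dominated_right A B :
    A \in ropts G -> B \in ropts G -> ~~ same A B -> dge A B ->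
    reduces G (Game (lopts G) (remove A (ropts G)))
| nonatomic_left A B :
    A \in lopts G -> B \in ropts A -> dge G B -> lopts B <> [::] ->
    reduces G (Game (lopts B ++ remove A (lopts G)) (ropts G))
| nonatomic_right A B :
    A \in ropts G -> B \in lopts A -> dge B G -> ropts B <> [::] ->
    reduces G (Game (lopts G) (ropts B ++ remove A (ropts G)))
| atomic_left A :
    A \in lopts G -> latomic_rev G A ->
    reduces G
      (Game (if has (fun X => ~~ wins_first Right X) (remove A (lopts G))
             then remove A (lopts G) else star :: remove A (lopts G))
            (ropts G))
| atomic_right A :
    A \in ropts G -> ratomic_rev G A ->
    reduces G
      (Game (lopts G)
            (if has (fun X => ~~ wins_first Left X) (remove A (ropts G))
             then remove A (ropts G) else star :: remove A (ropts G)))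
| substitution A C :
    same G (Game [:: A] [:: C]) -> latomic_rev G A -> ratomic_rev G C ->
    reduces G zero.

(* A reduction may apply as long as it leaves the option sets unchanged:      *)
(* replacing the atomic-reversible option * by * does not break               *)
(* canonicity.                                                                *)
Definition canonical (G : game) : Prop :=
  forall F F', follower G F -> reduces F F' -> same F' F.

(* Main.v *)
Require Import Defs.
From mathcomp Require Import all_boot.
From Stdlib Require Import Classical.

(** If no follower of [G] has [G' - G'] in P, then [G - G >= 0]: Left mirrors
    Right's moves, and the outcome of [G - G], which is N or P by symmetry,
    supplies the proviso of the comparison test.  The symmetric argument gives
    [G - G <= 0], so [-G] is an inverse.

    Conversely let [G + H = 0].  If [J <= 0], then after any Left move in [J]
    Right can restore [<= 0] (otherwise a test game built from adjoints tells
    [J] and [0] apart).  Answering a Left move of [G] in [G + H] therefore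
    shows that this option is either reversible, hence [*] by canonicity, or
    dominated by an option with the same partial inverse, hence invertible by
    canonicity.  By induction the proper followers satisfy [F - F = 0]; then
    [G + K <= 0] implies [K <= -G] for every [K], so [G - G >= G + H = 0] and
    [G - G] is not in P. *)

Set Implicit Arguments.
Unset Strict Implicit.
Unset Printing Implicit Defensive.

(** * Options indexed by player, and depth *)

(** Indexing by the player lets each Left/Right pair of statements be proved once. *)
Definition opts (p : player) (G : game) : seq game :=
  if p is Left then lopts G else ropts G.

Lemma opponentK : involutive opponent. Proof. by case. Qed.

Lemma game_opts_ind (P : game -> Prop) :
  (forall G, (forall p X, X \in opts p G -> P X) -> P G) -> forall G, P G.
Proof.
have inP s : foldr (fun X => and (P X)) True s -> forall X, X \in s -> P X.
  by elim: s => // Y s IHs [PY /IHs Ps] X; rewrite inE => /predU1P[->|/Ps].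
move=> IH; elim/game_nested_ind=> L R hL hR; apply: IH => -[] X /=.
  exact: inP hL X.
exact: inP hR X.
Qed.

(** The birthday of the form. It supports inductions that descend two moves at once, and it tells a
    game apart from its proper followers up to [same]. *)
Fixpoint depth (G : game) : nat :=
  let: Game L R := G in
  maxn (foldr maxn 0 (map (fun X => (depth X).+1) L))
       (foldr maxn 0 (map (fun X => (depth X).+1) R)).

Lemma depth_opts p G X : X \in opts p G -> depth X < depth G.
Proof.
have inP s : X \in s -> depth X < foldr maxn 0 (map (fun X => (depth X).+1) s).
  elim: s => //= Y s IHs; rewrite inE leq_max => /predU1P[->|/IHs ->].
    by rewrite leqnn.
  by rewrite orbT.
by case: G => L R; case: p => /= /inP h; rewrite leq_max h ?orbT.
Qed.

Lemma depth_le G n : (forall p X, X \in opts p G -> depth X < n) -> depth G <= n.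
Proof.
have inP s : (forall X, X \in s -> depth X < n) ->
    foldr maxn 0 (map (fun X => (depth X).+1) s) <= n.
  elim: s => //= Y s IHs h; rewrite geq_max h ?mem_head //=.
  by apply: IHs => X Xs; apply: h; rewrite inE Xs orbT.
case: G => L R h; rewrite /= geq_max !inP // => X.
  exact: (h Right).
exact: (h Left).
Qed.

Lemma depth_ind (P : game -> Prop) :
  (forall G, (forall X, depth X < depth G -> P X) -> P G) -> forall G, P G.
Proof.
move=> IH G; have [n] := ubnP (depth G); elim: n G => // n IHn G ltGn.
by apply: IH => X ltXG; apply: IHn; apply: leq_trans ltXG _.
Qed.

Lemma gameP G H : (forall p, opts p G = opts p H) -> G = H.
Proof.
by case: G H => [L R] [L' R'] h; rewrite (h Left : L = L') (h Right : R = R').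
Qed.

(** * Winning moves and disjunctive sums *)

Lemma wins_firstE p G :
  wins_first p G =
  nilp (opts p G) || has (fun X => ~~ wins_first (opponent p) X) (opts p G).
Proof. by case: G => L R; case: p. Qed.

Lemma wins_firstP p G :
  reflect (opts p G = [::] \/
           exists2 X, X \in opts p G & ~~ wins_first (opponent p) X)
          (wins_first p G).
Proof.
by rewrite wins_firstE; apply: (iffP orP) => -[/nilP|/hasP]; tauto.
Qed.

Lemma wins_first_opt p G X :
  X \in opts p G -> ~~ wins_first (opponent p) X -> wins_first p G.
Proof. by move=> XG nX; apply/wins_firstP; right; exists X. Qed.

Lemma loses_firstP p G :
  reflect (opts p G <> [::] /\
           forall X, X \in opts p G -> wins_first (opponent p) X)
          (~~ wins_first p G).
Proof.
apply: (iffP idP) => [nG | [nz h]].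
  split=> [z | X XG]; first by move/wins_firstP: nG; apply; left.
  by apply: contraNT nG; apply: wins_first_opt.
by apply/wins_firstP=> -[//|[X /h -> //]].
Qed.

Lemma opts_gadd p G H :
  opts p (gadd G H) = map (gadd^~ H) (opts p G) ++ map (gadd G) (opts p H).
Proof. by case: G => L R; case: H => L' R'; case: p. Qed.

Lemma mem_opts_gadd p G H X : X \in opts p (gadd G H) ->
  (exists2 A, A \in opts p G & X = gadd A H) \/
  (exists2 B, B \in opts p H & X = gadd G B).
Proof.
by rewrite opts_gadd mem_cat => /orP[] /mapP[Y]; [left|right]; exists Y.
Qed.

Lemma opts_gadd_nil p G H :
  opts p (gadd G H) = [::] <-> opts p G = [::] /\ opts p H = [::].
Proof.
rewrite opts_gadd.
by case: (opts p G) (opts p H) => [|? ?] [|? ?]; split=> // -[].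
Qed.

Lemma opts_gaddl p G H A : A \in opts p G -> gadd A H \in opts p (gadd G H).
Proof. by move=> AG; rewrite opts_gadd mem_cat (map_f (gadd^~ H) AG). Qed.

Lemma opts_gaddr p G H A : A \in opts p H -> gadd G A \in opts p (gadd G H).
Proof. by move=> AH; rewrite opts_gadd mem_cat (map_f (gadd G) AH) orbT. Qed.

Lemma opts_gneg p G : opts p (gneg G) = map gneg (opts (opponent p) G).
Proof. by case: G => L R; case: p. Qed.

Lemma opts_gneg_mem p G A :
  A \in opts (opponent p) G -> gneg A \in opts p (gneg G).
Proof. by move=> AG; rewrite opts_gneg map_f. Qed.

Lemma gadd0g : left_id zero gadd.
Proof.
elim/game_opts_ind=> G IH; apply: gameP => p; rewrite opts_gadd.
have ->: opts p zero = [::] by case: p.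
by rewrite /= map_id_in // => X; apply: IH.
Qed.

Lemma gaddg0 : right_id zero gadd.
Proof.
elim/game_opts_ind=> G IH; apply: gameP => p; rewrite opts_gadd.
have ->: opts p zero = [::] by case: p.
by rewrite cats0 map_id_in // => X; apply: IH.
Qed.

(** Both bracketings list the options in the same order, so this is an equality of trees;
    commutativity will hold only up to [same]. *)
Lemma gaddA : associative gadd.
Proof.
elim/game_opts_ind=> G IHG; elim/game_opts_ind=> H IHH.
elim/game_opts_ind=> K IHK; apply: gameP => p.
rewrite !opts_gadd !map_cat -!map_comp -catA; congr (_ ++ (_ ++ _)).
- by apply/eq_in_map => X XG /=; rewrite (IHG p).
- by apply/eq_in_map => X XH /=; rewrite (IHH p).
by apply/eq_in_map => X XK /=; rewrite (IHK p).
Qed.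

(** * Set equality of forms *)

Lemma sameP G H :
  reflect (forall p, (forall X, X \in opts p G -> exists2 Y, Y \in opts p H & same X Y)
                  /\ (forall Y, Y \in opts p H -> exists2 X, X \in opts p G & same X Y))
          (same G H).
Proof.
case: G H => [L R] [L' R'] /=; apply: (iffP and4P).
  case=> /allP h1 /allP h2 /allP h3 /allP h4.
  by case; split=> X /=; [move/h1|move/h2|move/h3|move/h4] => /hasP.
move=> h; have [h1 h2] := h Left; have [h3 h4] := h Right.
by split; apply/allP=> X XL; apply/hasP; [apply: h1|apply: h2|apply: h3|apply: h4].
Qed.

Lemma same_refl G : same G G.
Proof.
elim/game_opts_ind: G => G IH; apply/sameP=> p.
by split=> X XG; exists X => //; apply: IH XG.
Qed.

Lemma same_sym G H : same G H -> same H G.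
Proof.
elim/game_opts_ind: G H => G IH H /sameP s; apply/sameP=> p; have [s1 s2] := s p.
split=> X.
  by case/s2=> Y YG YX; exists Y => //; apply: IH YG _ YX.
by move=> XG; have [Y YH XY] := s1 X XG; exists Y => //; apply: IH XG _ XY.
Qed.

Lemma same_wins_first G H p : same G H -> wins_first p G = wins_first p H.
Proof.
have imp G' H' q : (forall r X Y, X \in opts r G' -> same X Y ->
      wins_first (opponent r) X = wins_first (opponent r) Y) ->
    same G' H' -> wins_first q G' = wins_first q H'.
  move=> IH /sameP /(_ q)[s1 s2]; apply/wins_firstP/wins_firstP.
    case=> [z | [X XG nX]].
      left; case E: (opts q H') => [//|Y s].
      by have [|X] := s2 Y; rewrite ?z // E mem_head.
    have [Y YH XY] := s1 X XG; right; exists Y => //.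
    by rewrite -(IH q X Y).
  case=> [z | [Y YH nY]].
    left; case E: (opts q G') => [//|X s].
    by have [|Y] := s1 X; rewrite ?z // E mem_head.
  have [X XG XY] := s2 Y YH; right; exists X => //.
  by rewrite (IH q X Y).
elim/game_opts_ind: G H p => G IH H p; apply: imp => r X Y XG.
exact: IH XG _ _.
Qed.

Lemma same_outcome G H : same G H -> outcome G = outcome H.
Proof. by move=> s; rewrite /outcome !(same_wins_first _ s). Qed.

Lemma same_gadd2r G H K : same G H -> same (gadd G K) (gadd H K).
Proof.
elim/game_opts_ind: G H K => G IHG H; elim/game_opts_ind=> K IHK s.
apply/sameP=> p; have [s1 s2] := sameP _ _ s p.
split=> X /mem_opts_gadd[] [A AG ->].
- have [B BH AB] := s1 A AG.
  by exists (gadd B K); [apply: opts_gaddl | apply: IHG AG _ _ AB].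
- by exists (gadd H A); [apply: opts_gaddr | apply: IHK AG s].
- have [B BH AB] := s2 A AG.
  by exists (gadd B K); [apply: opts_gaddl | apply: IHG BH _ _ AB].
by exists (gadd G A); [apply: opts_gaddr | apply: IHK AG s].
Qed.

Lemma same_gaddC G H : same (gadd G H) (gadd H G).
Proof.
elim/game_opts_ind: G H => G IHG; elim/game_opts_ind=> H IHH.
apply/sameP=> p; split=> X /mem_opts_gadd[] [A AX ->].
- by exists (gadd H A); [apply: opts_gaddr | apply: IHG AX _].
- by exists (gadd A G); [apply: opts_gaddl | apply: IHH AX].
- by exists (gadd G A); [apply: opts_gaddr | apply: IHH AX].
by exists (gadd A H); [apply: opts_gaddl | apply: IHG AX _].
Qed.

Lemma same_trans G H K : same G H -> same H K -> same G K.
Proof.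
elim/game_opts_ind: G H K => G IH H K /sameP s /sameP t; apply/sameP=> p.
have [s1 s2] := s p; have [t1 t2] := t p; split=> [X XG | Z ZK].
  have [Y YH XY] := s1 X XG; have [Z ZK YZ] := t1 Y YH.
  by exists Z => //; apply: IH XG _ _ XY YZ.
have [Y YH YZ] := t2 Z ZK; have [X XG XY] := s2 Y YH.
by exists X => //; apply: IH XG _ _ XY YZ.
Qed.

Lemma same_gadd G G' H H' :
  same G G' -> same H H' -> same (gadd G H) (gadd G' H').
Proof.
move=> sG sH; apply: same_trans (same_gadd2r H sG) _.
apply: same_trans (same_gaddC _ _) _.
by apply: same_trans (same_gadd2r G' sH) _; apply: same_gaddC.
Qed.

Lemma same_gneg G H : same G H -> same (gneg G) (gneg H).
Proof.
elim/game_opts_ind: G H => G IH H /sameP s; apply/sameP=> p.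
have [s1 s2] := s (opponent p); rewrite !opts_gneg.
split=> X /mapP[Y YG ->].
  have [Z ZH YZ] := s1 Y YG.
  by exists (gneg Z); [apply: map_f | apply: IH YG _ YZ].
have [Z ZH YZ] := s2 Y YG.
by exists (gneg Z); [apply: map_f | apply: IH ZH _ YZ].
Qed.

Lemma same_depth G H : same G H -> depth G = depth H.
Proof.
have le G' H' : same G' H' -> depth G' <= depth H'.
  elim/game_opts_ind: G' H' => G' IH H' /sameP s; apply: depth_le => p X XG.
  have [Y YH XY] := (s p).1 X XG.
  exact: leq_ltn_trans (IH _ _ XG _ XY) (depth_opts YH).
by move=> s; apply/eqP; rewrite eqn_leq !le //; apply: same_sym.
Qed.

Lemma same_zero G : same G zero -> G = zero.
Proof.
move=> /sameP s; apply: gameP => p; have [s1 _] := s p.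
have z: opts p zero = [::] by case: (p).
rewrite z in s1 *; case E: (opts p G) => [//|X t].
by have [|Y] := s1 X; rewrite ?E ?mem_head.
Qed.

(** * Dicotic games *)

Lemma follower_opt p G F X : follower G F -> X \in opts p F -> follower G X.
Proof. by case: p => /= GF XF; [apply: follower_left XF|apply: follower_right XF]. Qed.

Lemma follower_trans G F K : follower G F -> follower F K -> follower G K.
Proof.
move=> GF; elim=> // {K} [K X _ GK XK | K X _ GK XK].
  exact: (@follower_opt Left) GK XK.
exact: (@follower_opt Right) GK XK.
Qed.

Lemma followerE G F :
  follower G F -> F = G \/ exists p X, X \in opts p G /\ follower X F.
Proof.
suff step K X p : K = G \/ (exists p X, X \in opts p G /\ follower X K) ->
    X \in opts p K -> X = G \/ exists p X', X' \in opts p G /\ follower X' X.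
  elim=> [|K X _ IH XK|K X _ IH XK]; first by left.
    exact: (step K X Left).
  exact: (step K X Right).
move=> [-> | [q [Y [YG YK]]]] XK; right.
  by exists p, X; split=> //; apply: follower_refl.
by exists q, Y; split=> //; apply: follower_opt XK.
Qed.

Lemma dicotic_follower G F : dicotic G -> follower G F -> dicotic F.
Proof. by move=> dG GF K FK; apply: dG; apply: follower_trans FK. Qed.

Lemma dicotic_opt p G X : dicotic G -> X \in opts p G -> dicotic X.
Proof.
by move=> dG XG; apply: dicotic_follower dG (follower_opt (follower_refl G) XG).
Qed.

Lemma dicotic_nil p G : dicotic G -> opts p G = [::] -> G = zero.
Proof.
move=> dG; have [h1 h2] := dG _ (follower_refl G).
case: G dG h1 h2 => L R _ h1 h2; case: p => /= z.
  by rewrite z (h1 z : R = _).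
by rewrite z (h2 z : L = _).
Qed.

Lemma dicoticI G : (lopts G = [::] <-> ropts G = [::]) ->
  (forall p X, X \in opts p G -> dicotic X) -> dicotic G.
Proof.
move=> z h F /followerE[-> // | [p [X [XG XF]]]].
exact: dicotic_follower (h p X XG) XF _ (follower_refl F).
Qed.

Lemma dicotic_zero : dicotic zero.
Proof. by apply: dicoticI => // -[]. Qed.

Lemma dicotic_star : dicotic star.
Proof.
by apply: dicoticI => // -[] X /=; rewrite inE => /eqP->; apply: dicotic_zero.
Qed.

Lemma dicotic_cons p A B s t G :
  opts p G = A :: s -> opts (opponent p) G = B :: t ->
  (forall X, X \in A :: s -> dicotic X) -> (forall X, X \in B :: t -> dicotic X) ->
  dicotic G.
Proof.
move=> ep eo ds dt; apply: dicoticI; first by case: p ep eo => /= -> ->.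
move=> q X; by case: p q ep eo => -[] /= e e'; rewrite ?e ?e';
  [apply: ds | apply: dt | apply: dt | apply: ds].
Qed.

Lemma dicotic_gadd G H : dicotic G -> dicotic H -> dicotic (gadd G H).
Proof.
elim/game_opts_ind: G H => G IHG; elim/game_opts_ind=> H IHH dG dH.
apply: dicoticI.
  have gG := dG _ (follower_refl G); have gH := dH _ (follower_refl H).
  have := opts_gadd_nil Left G H; have := opts_gadd_nil Right G H.
  by rewrite /=; tauto.
move=> p X /mem_opts_gadd[] [A AX ->].
  by apply: IHG AX _ (dicotic_opt dG AX) dH.
by apply: IHH AX dG (dicotic_opt dH AX).
Qed.

Lemma dicotic_gneg G : dicotic G -> dicotic (gneg G).
Proof.
elim/game_opts_ind: G => G IH dG; apply: dicoticI.
  have [g1 g2] := dG _ (follower_refl G).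
  by case: (G) g1 g2 => [[|? ?] [|? ?]] g1 g2; split=> // _;
    [have := g1 erefl | have := g2 erefl].
move=> p X; rewrite opts_gneg => /mapP[Y YG ->].
exact: IH YG (dicotic_opt dG YG).
Qed.

Lemma gneg_eq0 G : gneg G = zero -> G = zero.
Proof. by case: G => [[|A L] [|B R]]. Qed.

Lemma wins_first_gneg p G : wins_first p (gneg G) = wins_first (opponent p) G.
Proof.
elim/game_opts_ind: G p => G IH p; rewrite !wins_firstE opts_gneg /nilp size_map.
congr (_ || _); rewrite has_map; apply: eq_in_has => X XG /=.
by rewrite (IH _ X XG).
Qed.

Lemma gneg_gadd G H : gneg (gadd G H) = gadd (gneg G) (gneg H).
Proof.
elim/game_opts_ind: G H => G IHG; elim/game_opts_ind=> H IHH.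
apply: gameP => p; rewrite opts_gneg !opts_gadd !opts_gneg map_cat -!map_comp.
congr (_ ++ _); apply/eq_in_map => X XG /=.
  exact: IHG XG _.
exact: IHH XG.
Qed.

Lemma gnegK : involutive gneg.
Proof.
elim/game_opts_ind=> G IH; apply: gameP => p.
rewrite !opts_gneg opponentK -map_comp map_id_in // => X XG /=.
exact: IH XG.
Qed.

Lemma wins_first_gaddC p G H :
  wins_first p (gadd G H) = wins_first p (gadd H G).
Proof. exact: same_wins_first (same_gaddC G H). Qed.

(** Conjugation exchanges the players and sends [G - G] to [-G + G], so the outcome of [G - G] can
    only be N or P. *)
Lemma wins_first_gadd_gneg p G :
  wins_first p (gadd G (gneg G)) = wins_first (opponent p) (gadd G (gneg G)).
Proof. by rewrite -wins_first_gneg gneg_gadd gnegK wins_first_gaddC. Qed.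

Lemma outcome_gadd_gneg G p :
  outcome (gadd G (gneg G)) <> OP <-> wins_first p (gadd G (gneg G)).
Proof.
have := wins_first_gadd_gneg Left G.
by rewrite /outcome; case: p => /= <-; case: (wins_first Left _).
Qed.

(** * The order modulo dicotic games *)

(* [dge_for Left G H] is [G >= H] and [dge_for Right G H] is [G <= H]. *)
Definition dge_for (p : player) (G H : game) : Prop :=
  forall X, dicotic X ->
    (wins_first p (gadd H X) -> wins_first p (gadd G X)) /\
    (wins_first (opponent p) (gadd G X) -> wins_first (opponent p) (gadd H X)).

Lemma dge_for_opponent p G H : dge_for (opponent p) G H <-> dge_for p H G.
Proof. by split=> h X /h[]; rewrite opponentK. Qed.

Lemma dge_leftE G H : dge G H <-> dge_for Left G H.
Proof.
split=> h X dX; have := h X dX; rewrite /outcome /=;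
  do 4!case: (wins_first _ _) => //=; by [split; auto | case; auto].
Qed.

Lemma dge_rightE G H : dge G H <-> dge_for Right H G.
Proof. by rewrite dge_leftE; apply: iff_sym; apply: (dge_for_opponent Left). Qed.

Lemma deqE p G H : deq G H <-> dge_for p G H /\ dge_for p H G.
Proof.
split=> [h | [h1 h2] X dX].
  by split=> X /h; rewrite /outcome; case: p => /=;
    do 4!case: (wins_first _ _) => //=; auto.
have [a b] := h1 X dX; have [c d] := h2 X dX.
have: wins_first p (gadd G X) = wins_first p (gadd H X) by apply/idP/idP.
have: wins_first (opponent p) (gadd G X) = wins_first (opponent p) (gadd H X).
  by apply/idP/idP.
by rewrite /outcome; case: (p) => /= -> ->.
Qed.

Lemma dge_for_trans p H G K : dge_for p G H -> dge_for p H K -> dge_for p G K.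
Proof. by move=> h1 h2 X dX; have := h1 X dX; have := h2 X dX; tauto. Qed.

Lemma dge_for_same p G H : same G H -> dge_for p G H.
Proof. by move=> s X dX; rewrite !(same_wins_first _ (same_gadd2r X s)). Qed.

Lemma dge_for_gadd2r p G H K :
  dicotic K -> dge_for p G H -> dge_for p (gadd G K) (gadd H K).
Proof. by move=> dK h X dX; rewrite -!gaddA; apply: h; apply: dicotic_gadd. Qed.

Lemma dge_for_gadd2l p G H K :
  dicotic K -> dge_for p G H -> dge_for p (gadd K G) (gadd K H).
Proof.
move=> dK h; apply: dge_for_trans (dge_for_same _ (same_gaddC _ _)) _.
by apply: dge_for_trans (dge_for_gadd2r dK h) (dge_for_same _ (same_gaddC _ _)).
Qed.

(* A <= A + (B + K) = (A + K) + B <= B *)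
Lemma dge_for_cancel p A B K :
  dicotic A -> dicotic B ->
  dge_for p zero (gadd A K) -> dge_for p (gadd B K) zero -> dge_for p B A.
Proof.
move=> dA dB hA hB.
have h1 := dge_for_gadd2l dA hB; rewrite gaddg0 in h1.
have h2 := dge_for_gadd2r dB hA; rewrite gadd0g -gaddA in h2.
apply: dge_for_trans h2 _; apply: dge_for_trans h1.
by apply: dge_for_same; apply: same_gadd (same_refl A) (same_gaddC _ _).
Qed.

(** One half of the comparison test, as a transfer of winning first moves from [H + X] to [G + X];
    [hX] stands for the induction on [X]. The condition on [H = zero] covers the end of play, where
    misère play rewards the player who cannot move. *)
Lemma wins_first_gadd_mono p G H X :
  dicotic H -> dicotic X ->
  (H = zero -> wins_first p G) ->
  (forall A, A \in opts p H ->
     (exists2 B, B \in opts p G & dge_for p B A) \/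
     (exists2 C, C \in opts (opponent p) A & dge_for p G C)) ->
  (forall Y, Y \in opts p X -> wins_first (opponent p) (gadd G Y) ->
     wins_first (opponent p) (gadd H Y)) ->
  wins_first p (gadd H X) -> wins_first p (gadd G X).
Proof.
move=> dH dX z h hX /wins_firstP[].
  case/opts_gadd_nil=> eH eX.
  by rewrite (dicotic_nil dX eX) gaddg0; apply/z/(dicotic_nil dH eH).
case=> Y /mem_opts_gadd[] [A AY ->] nA.
  case: (h A AY) => [[B BG BA] | [C CA GC]].
    apply: wins_first_opt (opts_gaddl X BG) _.
    by apply: contra nA; apply: (BA X dX).2.
  (* The opponent loses moving first from [A + X], in particular by moving to [C + X]; so [p] wins
     moving first there, hence also from [G + X]. *)
  apply: (GC X dX).1; have [_ /(_ _ (opts_gaddl X CA))] := loses_firstP _ _ nA.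
  by rewrite opponentK.
by apply: wins_first_opt (opts_gaddr G AY) _; apply: contra nA; apply: hX.
Qed.

(** The comparison test. The two halves of the order are the same transfer with players and games
    exchanged, and each feeds the other in the induction on [X]. The two conditions on [zero] are
    the misère proviso. *)
Lemma dge_for_intro p G H :
  dicotic G -> dicotic H ->
  (H = zero -> wins_first p G) -> (G = zero -> wins_first (opponent p) H) ->
  (forall A, A \in opts p H ->
     (exists2 B, B \in opts p G & dge_for p B A) \/
     (exists2 C, C \in opts (opponent p) A & dge_for p G C)) ->
  (forall A, A \in opts (opponent p) G ->
     (exists2 B, B \in opts (opponent p) H & dge_for p A B) \/
     (exists2 C, C \in opts p A & dge_for p C H)) ->
  dge_for p G H.
Proof.
move=> dG dH zH zG hH hG; elim/game_opts_ind=> X IH dX; split.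
  by apply: wins_first_gadd_mono => // Y YX; apply: (IH _ Y YX (dicotic_opt dX YX)).2.
apply: wins_first_gadd_mono => // [A /hG | Y YX].
  rewrite opponentK => -[[B BH AB] | [C CA CH]]; [left|right].
    by exists B => //; apply/dge_for_opponent.
  by exists C => //; apply/dge_for_opponent.
by rewrite opponentK; apply: (IH _ Y YX (dicotic_opt dX YX)).1.
Qed.

(** * Test games *)

Definition mkgame (p : player) (s t : seq game) : game :=
  if p is Left then Game s t else Game t s.

Lemma opts_mkgame p s t : opts p (mkgame p s t) = s.
Proof. by case: p. Qed.

Lemma opts_mkgame_opponent p s t : opts (opponent p) (mkgame p s t) = t.
Proof. by case: p. Qed.

(** The misère adjoint: the conjugate with every terminal position replaced by [star]. *)
Fixpoint adjoint (G : game) : game :=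
  let: Game L R := G in
  if nilp L && nilp R then star else Game (map adjoint R) (map adjoint L).

Lemma opts_adjoint p G : G <> zero ->
  opts p (adjoint G) = map adjoint (opts (opponent p) G).
Proof. by case: G p => [[|A L] [|B R]] []. Qed.

Lemma dicotic_adjoint G : dicotic G -> dicotic (adjoint G).
Proof.
elim/game_opts_ind: G => G IH dG.
have [-> | /eqP nz] := eqVneq G zero; first exact: dicotic_star.
apply: dicoticI.
  have [g1 g2] := dG _ (follower_refl G).
  by case: (G) g1 g2 => [[|? ?] [|? ?]] g1 g2; split=> // _;
    [have := g1 erefl | have := g2 erefl].
move=> p X; rewrite opts_adjoint // => /mapP[Y YG ->].
exact: IH YG (dicotic_opt dG YG).
Qed.

(** The second player mirrors every move until [0 + *] is reached with the first player to move; the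
    forced move to [0] then leaves the second player without a move, which wins. *)
Lemma adjoint_loses_first p G :
  dicotic G -> ~~ wins_first p (gadd G (adjoint G)).
Proof.
elim/game_opts_ind: G p => G IH p dG.
have [-> | /eqP nz] := eqVneq G zero; first by case: p.
apply/loses_firstP; split.
  by case/opts_gadd_nil=> /(dicotic_nil dG).
move=> X /mem_opts_gadd[] [A AX ->].
  have := IH _ A AX (opponent (opponent p)) (dicotic_opt dG AX).
  apply: wins_first_opt; apply: opts_gaddr; rewrite opts_adjoint // opponentK.
  exact: map_f.
move: AX; rewrite opts_adjoint // => /mapP[B BG ->].
have := IH _ B BG (opponent (opponent p)) (dicotic_opt dG BG).
by apply: wins_first_opt; apply: opts_gaddl.
Qed.

(* If [X] separates 0 from [C] with the wrong player to move, then a waiting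
   move to [X] fixes this; adjoints punish every other move. *)
Lemma not_zero_dge_for p C : dicotic C -> ~ dge_for p zero C ->
  exists Y, [/\ dicotic Y, wins_first (opponent p) Y
              & ~~ wins_first (opponent p) (gadd C Y)].
Proof.
move=> dC nge; apply: NNPP => nY; apply: nge => X dX.
rewrite gadd0g; split=> hX; last first.
  by apply: contraT => nCX; case: nY; exists X.
apply: contraT => nX; case: nY.
(* The opponent's only move is the waiting move to [X]; the entry [zero] keeps the game dicotic
   whatever the options of [C] are. *)
exists (mkgame p (zero :: map adjoint (opts (opponent p) C)) [:: X]); split.
- apply: (dicotic_cons (opts_mkgame p _ _) (opts_mkgame_opponent p _ _)) => Y.
    rewrite inE => /predU1P[-> | /mapP[Z ZC ->]]; first exact: dicotic_zero.
    exact: dicotic_adjoint (dicotic_opt dC ZC).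
  by rewrite inE => /eqP->.
- apply: (@wins_first_opt _ _ X); rewrite ?opponentK //.
  by rewrite opts_mkgame_opponent mem_head.
apply/loses_firstP; split.
  by rewrite opts_gadd opts_mkgame_opponent; case: (map _ _).
rewrite opponentK => Y /mem_opts_gadd[] [A].
  move=> AC ->; have := adjoint_loses_first (opponent p) (dicotic_opt dC AC).
  apply: wins_first_opt; apply: opts_gaddr.
  by rewrite opts_mkgame inE map_f ?orbT.
by rewrite opts_mkgame_opponent inE => /eqP-> ->.
Qed.

Lemma finite_choice (P : game -> game -> Prop) (Q : game -> Prop) (s : seq game) :
  (forall X, X \in s -> exists2 Y, Q Y & P X Y) ->
  exists2 t : seq game, (forall Y, Y \in t -> Q Y)
           & (forall X, X \in s -> exists2 Y, Y \in t & P X Y).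
Proof.
elim: s => [|A s IHs] h; first by exists [::].
have [|t tQ tP] := IHs; first by move=> X Xs; apply: h; rewrite inE Xs orbT.
have [B QB PAB] := h A (mem_head _ _).
exists (B :: t) => X; rewrite inE => /predU1P[-> //|]; first exact: tQ.
  by exists B; rewrite ?mem_head.
by case/tP=> Y Yt PXY; exists Y; rewrite // inE Yt orbT.
Qed.

(** If no reply [C] worked, each would have a test game [Y] as in [not_zero_dge_for]. Offering all
    of these to [p] in a single game [X] makes [p] win [J + X] by moving to [A + X], although [p]
    loses [X] alone when moving first. *)
Lemma zero_dge_for_response p J A :
  dicotic J -> dge_for p zero J -> A \in opts p J ->
  exists2 C, C \in opts (opponent p) A & dge_for p zero C.
Proof.
move=> dJ hJ AJ; apply: NNPP => nC; have dA := dicotic_opt dJ AJ.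
have [|t tQ tP] := @finite_choice
    (fun C Y => ~~ wins_first (opponent p) (gadd C Y))
    (fun Y => dicotic Y /\ wins_first (opponent p) Y) (opts (opponent p) A).
  move=> C CA; have [|Y [dY wY nY]] := @not_zero_dge_for p C (dicotic_opt dA CA).
    by move=> hC; apply: nC; exists C.
  by exists Y.
(* [T] will be the opponent's only move in [X]; from [A + T] player [p] goes to [A + adjoint A],
   lost for the opponent. *)
pose T := mkgame p [:: adjoint A] [:: zero].
have dT: dicotic T.
  apply: (dicotic_cons (opts_mkgame p _ _) (opts_mkgame_opponent p _ _)) => Y;
    rewrite inE => /eqP->; by [apply: dicotic_adjoint | apply: dicotic_zero].
(* The entry [zero] keeps [X] dicotic even if [t] is empty, and gives [p] no win in [X] alone: the
   opponent, unable to move there, wins. *)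
pose X := mkgame p (zero :: t) [:: T].
have dX: dicotic X.
  apply: (dicotic_cons (opts_mkgame p _ _) (opts_mkgame_opponent p _ _)) => Y.
    by rewrite inE => /predU1P[-> | /tQ[]//]; apply: dicotic_zero.
  by rewrite inE => /eqP->.
have: wins_first p (gadd J X).
  apply: (wins_first_opt (opts_gaddl X AJ)); apply/loses_firstP; split.
    by rewrite opts_gadd opts_mkgame_opponent; case: (map _ _).
  rewrite opponentK => Y /mem_opts_gadd[] [B].
    move=> BA ->; have [Z Zt nZ] := tP B BA.
    apply: wins_first_opt nZ; apply: opts_gaddr.
    by rewrite opts_mkgame inE Zt orbT.
  rewrite opts_mkgame_opponent inE => /eqP-> ->.
  apply: wins_first_opt (adjoint_loses_first (opponent p) dA).
  by apply: opts_gaddr; rewrite opts_mkgame mem_head.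
move/(hJ X dX).1; rewrite gadd0g; apply/negP/loses_firstP.
rewrite opts_mkgame; split=> // Y; rewrite inE => /predU1P[-> | /tQ[]//].
by case: (p).
Qed.

(** * Conjugates and inverses *)

Lemma gadd_gneg_dge0 G : dicotic G ->
  (forall F, follower G F -> outcome (gadd F (gneg F)) <> OP) ->
  forall p, dge_for p (gadd G (gneg G)) zero.
Proof.
elim/game_opts_ind: G => G IH dG hG p.
(* The fact [win] below supplies the proviso of [dge_for_intro] for comparison with [zero]; the
   mirror image of each move leads to some [X - X], covered by induction. *)
have dN := dicotic_gneg dG.
have win q: wins_first q (gadd G (gneg G)).
  by apply/outcome_gadd_gneg/hG/follower_refl.
have IHX q X : X \in opts q G -> dge_for p (gadd X (gneg X)) zero.
  move=> XG; apply: (IH _ _ XG (dicotic_opt dG XG)) => F XF.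
  by apply/hG/(follower_trans _ XF)/(follower_opt (follower_refl G) XG).
apply: dge_for_intro => //; first exact: dicotic_gadd.
- exact: dicotic_zero.
- by case: (p).
- by case: (p).
move=> A /mem_opts_gadd[] [B BG ->]; right.
  exists (gadd B (gneg B)); last exact: IHX BG.
  by apply: opts_gaddr; rewrite opts_gneg map_f.
move: BG; rewrite opts_gneg opponentK => /mapP[C CG ->].
by exists (gadd C (gneg C)); [apply: opts_gaddl | apply: IHX CG].
Qed.

(** Cancelling [G] directly would require [G - G >= 0], which is not known here. The comparison test
    is run on [-G] and [K] instead, so that cancellation, in [neg_ge], is applied only to proper
    followers of [G]. *)
Lemma dge_for_gneg p G K : dicotic G -> dicotic K ->
  (forall q A, A \in opts q G ->
     forall F, follower A F -> outcome (gadd F (gneg F)) <> OP) ->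
  dge_for p zero (gadd G K) -> dge_for p (gneg G) K.
Proof.
move=> dG + good; have dN := dicotic_gneg dG.
have neg_ge B D q F : B \in opts q G -> follower B F -> dicotic D ->
    dge_for p zero (gadd F D) -> dge_for p (gneg F) D.
  move=> BG BF dD hFD; have dF := dicotic_follower (dicotic_opt dG BG) BF.
  apply: (@dge_for_cancel p D (gneg F) F) => //; first exact: dicotic_gneg.
    by apply: dge_for_trans hFD (dge_for_same _ (same_gaddC _ _)).
  apply: dge_for_trans (dge_for_same _ (same_gaddC _ _)) _.
  by apply: gadd_gneg_dge0 dF _ _ => E FE; apply: good BG _ (follower_trans BF FE).
(* Induction on depth, since a move in [K] answered within [K] lands two moves down. *)
elim/depth_ind: K => K IH dK hGK; apply: dge_for_intro => //.
- move=> K0; rewrite K0 gaddg0 in hGK.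
  have := (hGK zero dicotic_zero).2.
  by rewrite !gaddg0 wins_first_gneg; apply; case: (p).
- move=> /gneg_eq0 G0; rewrite G0 gadd0g in hGK.
  by have := (hGK zero dicotic_zero).2; rewrite !gaddg0; apply; case: (p).
- move=> A AK; have dA := dicotic_opt dK AK.
  have [C] := zero_dge_for_response (dicotic_gadd dG dK) hGK (opts_gaddr G AK).
  case/mem_opts_gadd=> -[B BX ->] hC; [left|right].
    exists (gneg B); first exact: opts_gneg_mem.
    exact: neg_ge BX (follower_refl B) dA hC.
  exists B => //; apply: IH hC; last exact: dicotic_opt BX.
  exact: ltn_trans (depth_opts BX) (depth_opts AK).
move=> A'; rewrite opts_gneg opponentK => /mapP[A AG ->].
have [C] := zero_dge_for_response (dicotic_gadd dG dK) hGK (opts_gaddl K AG).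
case/mem_opts_gadd=> -[B BX ->] hC; [right|left].
  exists (gneg B); first exact: opts_gneg_mem.
  exact: neg_ge AG (follower_opt (follower_refl A) BX) dK hC.
by exists B => //; apply: neg_ge AG (follower_refl A) (dicotic_opt dK BX) hC.
Qed.

(* Chasing the replies of both players replaces the canonical form of the
   inverse [K] by a descent into its followers. *)
Lemma inverse_option p G A K D : dicotic G -> dicotic K ->
  A \in opts p G -> D \in opts (opponent p) K ->
  dge_for p (gadd G K) zero -> dge_for p zero (gadd A D) ->
  (exists2 C, C \in opts (opponent p) A & dge_for p G C) \/
  (exists B E, [/\ B \in opts p G, dicotic E, dge_for p B A,
                   dge_for p (gadd B E) zero & dge_for p zero (gadd A E)]).
Proof.
move=> dG + AG; have dA := dicotic_opt dG AG.
elim/depth_ind: K D => K IH D dK DK hGK hAD; have dD := dicotic_opt dK DK.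
have [|C] := zero_dge_for_response (dicotic_gadd dG dK) _ (opts_gaddr G DK).
  exact/dge_for_opponent.
(* Reply in [G]: for [p = Left], [B + D >= 0 >= A + D], so [B] dominates [A] with [D] as common
   partial inverse. *)
rewrite opponentK => /mem_opts_gadd[] [B BX ->] /dge_for_opponent hB.
  right; exists B, D; split=> //.
  exact: dge_for_cancel dA (dicotic_opt dG BX) hAD hB.
(* Reply in [D]: now [G + B >= 0], and [p] may play the same move to [B] in [A + D]. An answer [E]
   in [A] gives [G >= E]; an answer in [B] restores the hypotheses with [B] in place of [K]. *)
have dB := dicotic_opt dD BX.
have [C'] := zero_dge_for_response (dicotic_gadd dA dD) hAD (opts_gaddr A BX).
case/mem_opts_gadd=> -[E EX ->] hE.
  left; exists E => //.
  exact: dge_for_cancel (dicotic_opt dA EX) dG hE hB.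
apply: (IH B) hE => //.
exact: ltn_trans (depth_opts BX) (depth_opts DK).
Qed.

(** Either [A] is reversible, or it is dominated by some [B] sharing the partial inverse [E], which
    becomes an inverse of [A] once canonicity identifies [A] with [B]. *)
Lemma invertible_opt p G A : dicotic G -> invertible G -> A \in opts p G ->
  (exists2 C, C \in opts (opponent p) A & dge_for p G C) \/
  (exists B E, [/\ B \in opts p G, dicotic E, dge_for p B A,
                   dge_for p (gadd B E) zero & dge_for p zero (gadd A E)]).
Proof.
move=> dG [H [dH /(deqE p)[GH0 H0G]]] AG; have dA := dicotic_opt dG AG.
have [C] := zero_dge_for_response (dicotic_gadd dG dH) H0G (opts_gaddl H AG).
case/mem_opts_gadd=> -[D DX ->] hD; last exact: inverse_option DX GH0 hD.
left; exists D => //.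
exact: dge_for_cancel (dicotic_opt dA DX) dG hD GH0.
Qed.

(** * Canonical forms *)

Lemma remove_same A X s : X \in remove A s -> ~~ same A X.
Proof.
by rewrite mem_filter => /andP[nXA _]; apply: contra nXA; apply: same_sym.
Qed.

Lemma canonical_opt p G A : canonical G -> A \in opts p G -> canonical A.
Proof.
move=> cG AG F F' AF; apply: cG.
exact: follower_trans (follower_opt (follower_refl G) AG) AF.
Qed.

(** Otherwise [A] could be removed, and no remaining option would be the same form as [A]. *)
Lemma canonical_dominated p G A B :
  canonical G -> A \in opts p G -> B \in opts p G -> dge_for p B A -> same A B.
Proof.
move=> cG; have red := cG G _ (follower_refl G).
case: p => /= AG BG hBA; apply: contraT => nAB.
  have /red/sameP/(_ Left)[_ /(_ A AG)[X /remove_same nAX /same_sym]] :=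
    dominated_left AG BG nAB ((dge_leftE _ _).2 hBA).
  by rewrite (negPf nAX).
have /red/sameP/(_ Right)[_ /(_ A AG)[X /remove_same nAX /same_sym]] :=
  dominated_right AG BG nAB ((dge_rightE _ _).2 hBA).
by rewrite (negPf nAX).
Qed.

(** The reduced option set must still contain a copy of [A]. Options of [B] are too shallow to be
    one, so [B] has to be [zero], and then only the inserted [star] can be the copy. *)
Lemma canonical_reversible p G A B :
  dicotic G -> canonical G -> A \in opts p G -> B \in opts (opponent p) A ->
  dge_for p G B -> same A star.
Proof.
move=> dG cG AG BA hGB; have red := cG G _ (follower_refl G).
have dB := dicotic_opt (dicotic_opt dG AG) BA.
have deep X : X \in opts p B -> same X A -> False.
  move=> XB /same_depth eXA; have := ltn_trans (depth_opts XB) (depth_opts BA).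
  by rewrite eXA ltnn.
have B0: B = zero.
  apply: (@dicotic_nil p) => //; apply: NNPP => nB.
  case: p AG BA hGB deep nB => /= AG BA hGB deep nB.
    have /red/sameP/(_ Left)[_ /(_ A AG)[X]] :=
      nonatomic_left AG BA ((dge_leftE _ _).2 hGB) nB.
    rewrite /= mem_cat => /orP[/deep h /h // | /remove_same nAX /same_sym].
    by rewrite (negPf nAX).
  have /red/sameP/(_ Right)[_ /(_ A AG)[X]] :=
    nonatomic_right AG BA ((dge_rightE _ _).2 hGB) nB.
  rewrite /= mem_cat => /orP[/deep h /h // | /remove_same nAX /same_sym].
  by rewrite (negPf nAX).
rewrite {}B0 in BA hGB; case: p AG BA hGB {deep} => /= AG BA hGB.
  have /red/sameP/(_ Left)[_ /(_ A AG)[X]] :=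
    atomic_left AG (conj BA ((dge_leftE _ _).2 hGB)).
  rewrite /=; case: ifP => _; last rewrite inE => /predU1P[-> /same_sym //|].
    by move=> /remove_same nAX /same_sym; rewrite (negPf nAX).
  by move=> /remove_same nAX /same_sym; rewrite (negPf nAX).
have /red/sameP/(_ Right)[_ /(_ A AG)[X]] :=
  atomic_right AG (conj BA ((dge_rightE _ _).2 hGB)).
rewrite /=; case: ifP => _; last rewrite inE => /predU1P[-> /same_sym //|].
  by move=> /remove_same nAX /same_sym; rewrite (negPf nAX).
by move=> /remove_same nAX /same_sym; rewrite (negPf nAX).
Qed.

(** Up to form, [F] is [*] or [0], and both [* + *] and [0 + 0] are N-positions. *)
Lemma same_star_follower A F : same A star -> follower A F ->
  outcome (gadd F (gneg F)) <> OP.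
Proof.
move=> sA /followerE[-> | [p [X [XA XF]]]].
  by rewrite (same_outcome (same_gadd sA (same_gneg sA))).
have X0: X = zero.
  have [Y YS XY] := (sameP _ _ sA p).1 X XA; apply: same_zero.
  by case: p YS {XA} XY => /=; rewrite inE => /eqP->.
by case/followerE: XF => [-> | [q [Y []]]]; rewrite X0 //; case: q.
Qed.

Lemma invertible_follower G F : dicotic G -> canonical G -> invertible G ->
  follower G F -> outcome (gadd F (gneg F)) <> OP.
Proof.
elim/game_opts_ind: G F => G IH F dG cG iG.
have good q A : A \in opts q G ->
    forall F', follower A F' -> outcome (gadd F' (gneg F')) <> OP.
  move=> AG F' AF'; have dA := dicotic_opt dG AG.
  case: (invertible_opt dG iG AG) => [[C CA hGC] | [B [E [BG dE BA hBE hAE]]]].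
    exact: same_star_follower (canonical_reversible dG cG AG CA hGC) AF'.
  (* Here [A] and [B] are the same form, so the two inequalities make [E] an inverse of [A] and
     induction applies. *)
  apply: (IH _ _ AG _ dA (canonical_opt cG AG) _ AF'); exists E; split=> //.
  apply/(deqE q); split=> //; apply: dge_for_trans hBE.
  exact: dge_for_same (same_gadd2r E (canonical_dominated cG AG BG BA)).
case/followerE=> [-> | [q [A [/good]]]]; last exact.
have [H [dH /(deqE Left)[GH0 H0G]]] := iG.
apply/(outcome_gadd_gneg G Left).
(* From [-G >= H] follows [G - G >= G + H >= 0]; tested at [zero], this passes Left's win in [0] on
   to [G - G]. *)
have /(dge_for_gadd2l dG) := dge_for_gneg dG dH good H0G.
move=> /dge_for_trans/(_ GH0)/(_ zero dicotic_zero)[].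
by rewrite !gaddg0 => ->.
Qed.

Theorem mainTheorem2 (G : game) (dG : dicotic G) (cG : canonical G) :
  invertible G <->
  ~ (exists G', follower G G' /\ outcome (gadd G' (gneg G')) = OP).
Proof.
split=> [iG [F [GF]] | good]; first exact: invertible_follower GF.
exists (gneg G); split; first exact: dicotic_gneg.
have h := gadd_gneg_dge0 dG (fun F GF oF => good (ex_intro _ F (conj GF oF))).
by apply/(deqE Left); split; [apply: h | apply/(dge_for_opponent Left)/h].
Qed.
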